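(* Let $\alpha,\beta$ be real numbers with $\alpha+\beta\neq -1,-2,\dots$. Put $\theta_n=-n(n+\alpha+\beta+1)$, $\sigma_n=2n+\alpha+\beta-1$, $u_j(n)=(n+\alpha)_j(n+\beta-j)_j$, and $r_0=1$, $r_j(x)=\prod_{i=0}^{j-1}[-x+(\alpha+i+1)(\beta-i)]$ for $j\ge 1$. Let $P_2$ be an arbitrary real polynomial of degree $k\ge 1$, written in the form $P_2(x)=\sum_{j=0}^kw_jr_j(x)$ for certain numbers $w_j$, and let $P_1$ be the polynomial of degree $k+1$ $$P_1(x)=\sum_{j=0}^kw_j\left(\frac{2}{j+1}r_{j+1}(x)+(\alpha-\beta+2j+1)r_j(x)\right).$$ Define $$\gamma_n=\sum_{j=0}^kw_ju_j(n)\ (n\ge 0),\qquad \beta_n=\frac{n+\alpha}{n+\alpha+\beta}\frac{\gamma_{n+1}}{\gamma_n}\ (n\ge 1),$$ $$\lambda_n=\frac{\sigma_n\gamma_n+P_1(\theta_{n-1})}{2}\ (n\ge 1),\qquad \lambda_0=\frac{P_1(0)-(\alpha+\beta+1)P_2(0)}{2},$$ where it is assumed that $\gamma_n\neq 0$ for $n\ge 0$. Define $q_0=1$ and $q_n=P_n^{\alpha,\beta}+\beta_nP_{n-1}^{\alpha,\beta}$ for $n\ge 1$, where $P_n^{\alpha,\beta}$ is the $n$-th Jacobi polynomial. Let $$D=\tfrac12P_1(D_{\alpha,\beta})+\left(-\tfrac{\alpha+\beta+1}{2}I+(1-x)\frac{d}{dx}\right)P_2(D_{\alpha,\beta}),$$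 where $D_{\alpha,\beta}$ is the second order Jacobi differential operator. Then $D$ is a differential operator of order $2k+2$, and $D(q_n)=\lambda_nq_n$ for all $n\ge 0$.
   Context: The sequence $(\beta_n)_n$ is not to be confused with the parameter $\beta$, nor the polynomials $P_1,P_2$ with the Jacobi polynomials $P_n^{\alpha,\beta}$. $(y)_j=y(y+1)\cdots(y+j-1)$, $(y)_0=1$. Jacobi polynomials: $P_n^{\alpha,\beta}(x)=2^{-n}\sum_{j=0}^n\binom{n+\alpha}{j}\binom{n+\beta}{n-j}(x-1)^{n-j}(x+1)^j$. Jacobi operator: $D_{\alpha,\beta}=(1-x^2)\left(\frac{d}{dx}\right)^2+(\beta-\alpha-(\alpha+\beta+2)x)\frac{d}{dx}$, which satisfies $D_{\alpha,\beta}(P_n^{\alpha,\beta})=-n(n+\alpha+\beta+1)P_n^{\alpha,\beta}$. $I$ is the identity. For a linear operator $T$ and a polynomial $P(x)=\sum_ja_jx^j$, $P(T)=\sum_ja_jT^j$; products of operators are compositions. *)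

(* Defs.v *)
From mathcomp Require Import all_boot all_order all_algebra.

Set Implicit Arguments.
Unset Strict Implicit.
Unset Printing Implicit Defensive.

Import Order.TTheory GRing.Theory Num.Theory.
Local Open Scope ring_scope.

(* Rising factorial (y)_j = y (y + 1) ... (y + j - 1). *)
Definition poch (R : realFieldType) (y : R) (j : nat) : R :=
  \prod_(i < j) (y + i%:R).

(* Binomial coefficient with an arbitrary real upper argument. *)
Definition gbinom (R : realFieldType) (y : R) (j : nat) : R :=
  (\prod_(i < j) (y - i%:R)) / (j`!)%:R.

Definition jacobi (R : realFieldType) (a b : R) (n : nat) : {poly R} :=
  2%:R ^- n *: \sum_(j < n.+1)
    (gbinom (n%:R + a) j * gbinom (n%:R + b) (n - j)) *:
      (('X - 1) ^+ (n - j) * ('X + 1) ^+ j).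

(* Differential operators have polynomial coefficients and act on {poly R};
   in characteristic 0 this action determines the coefficients. *)
Definition jacobi_op (R : realFieldType) (a b : R) (p : {poly R}) : {poly R} :=
  (1 - 'X ^+ 2) * p^`(2) + ((b - a)%:P - (a + b + 2%:R) *: 'X) * p^`().

(* P(T) = \sum_j P_j T^j, powers of T being iterated compositions. *)
Definition poly_op (R : realFieldType) (P : {poly R})
    (T : {poly R} -> {poly R}) (p : {poly R}) : {poly R} :=
  \sum_(j < size P) P`_j *: iter j T p.

Definition diff_op_of_order (R : realFieldType) (m : nat)
    (T : {poly R} -> {poly R}) : Prop :=
  exists c : nat -> {poly R},
    c m != 0 /\ forall p : {poly R}, T p = \sum_(i < m.+1) c i * p^`(i).

Definition theta_seq (R : realFieldType) (a b : R) (n : nat) : R :=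
  - (n%:R * (n%:R + a + b + 1)).

Definition sigma_seq (R : realFieldType) (a b : R) (n : nat) : R :=
  2%:R * n%:R + a + b - 1.

Definition upoch (R : realFieldType) (a b : R) (j n : nat) : R :=
  poch (n%:R + a) j * poch (n%:R + b - j%:R) j.

Definition rpoly (R : realFieldType) (a b : R) (j : nat) : {poly R} :=
  \prod_(i < j) (- 'X + ((a + i%:R + 1) * (b - i%:R))%:P).

Definition P1_of (R : realFieldType) (a b : R) (k : nat) (w : nat -> R) :
    {poly R} :=
  \sum_(j < k.+1) w j *:
    ((2%:R / j.+1%:R) *: rpoly a b j.+1
     + (a - b + 2%:R * j%:R + 1) *: rpoly a b j).

Definition gamma_seq (R : realFieldType) (a b : R) (k : nat) (w : nat -> R)
    (n : nat) : R :=
  \sum_(j < k.+1) w j * upoch a b j n.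

(* Only meaningful for n >= 1. *)
Definition beta_seq (R : realFieldType) (a b : R) (k : nat) (w : nat -> R)
    (n : nat) : R :=
  (n%:R + a) / (n%:R + a + b) * (gamma_seq a b k w n.+1 / gamma_seq a b k w n).

Definition lambda_seq (R : realFieldType) (a b : R) (k : nat) (w : nat -> R)
    (P2 : {poly R}) (n : nat) : R :=
  if n is m.+1 then
    (sigma_seq a b n * gamma_seq a b k w n + (P1_of a b k w).[theta_seq a b m]) / 2%:R
  else ((P1_of a b k w).[0] - (a + b + 1) * P2.[0]) / 2%:R.

Definition q_seq (R : realFieldType) (a b : R) (k : nat) (w : nat -> R)
    (n : nat) : {poly R} :=
  if n is m.+1 then jacobi a b n + beta_seq a b k w n *: jacobi a b m else 1.

Definition D_op (R : realFieldType) (a b : R) (P1 P2 : {poly R})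
    (p : {poly R}) : {poly R} :=
  let P2p := poly_op P2 (jacobi_op a b) p in
  2%:R^-1 *: poly_op P1 (jacobi_op a b) p
  + (- ((a + b + 1) / 2%:R) *: P2p + (1 - 'X) * P2p^`()).

(* Every polynomial of degree at most k has an expansion in r_0, ..., r_k. *)
Lemma rpoly_expansion (R : realFieldType) (a b : R) (k : nat) (P : {poly R}) :
  (size P <= k.+1)%N ->
  exists w : nat -> R, P = \sum_(j < k.+1) w j *: rpoly a b j.
Proof.
have szr j : size (rpoly a b j) = j.+1 /\ lead_coef (rpoly a b j) != 0.
  have H : size (rpoly a b j) = j.+1.
    rewrite /rpoly; elim: j => [|j IH]; first by rewrite big_ord0 size_poly1.
    have s2 (c : R) : size (- 'X + c%:P) = 2%N.
      by rewrite -size_polyN opprD opprK -polyCN size_XaddC.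
    rewrite big_ord_recr size_mul ?IH /= ?s2 ?addn2 //.
      by rewrite -size_poly_eq0 IH.
    by rewrite -size_poly_eq0 s2.
  by split=> //; rewrite lead_coef_eq0 -size_poly_eq0 H.
elim: k P => [|k IH] P sP.
  exists (fun=> P`_0); rewrite big_ord1 /rpoly big_ord0.
  by rewrite alg_polyC -size1_polyC.
have [szk lck] := szr k.+1.
set c := P`_k.+1 / lead_coef (rpoly a b k.+1).
have sQ : (size (P - c *: rpoly a b k.+1)%R <= k.+1)%N.
  apply/leq_sizeP => j; rewrite leq_eqVlt => /orP[/eqP<-|ltj].
    have Er : (rpoly a b k.+1)`_k.+1 = lead_coef (rpoly a b k.+1).
      by rewrite lead_coefE szk.
    by rewrite coefB coefZ Er divfK ?subrr.
  rewrite coefB coefZ !nth_default ?mulr0 ?subr0 ?szk //.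
  exact: leq_trans sP _.
have [w Ew] := IH _ sQ.
exists (fun j => if j == k.+1 then c else w j).
rewrite big_ord_recr /= eqxx -[LHS](subrK (c *: rpoly a b k.+1)) Ew.
congr (_ + _); apply: eq_bigr => i _.
by rewrite ltn_eqF.
Qed.

(* Main.v *)
Require Import Defs.
From mathcomp Require Import all_boot all_order all_algebra.
From mathcomp Require Import ring.

(** Write p_n for the Jacobi polynomial of degree n and
    Delta p = - ((a + b + 1) / 2) p + (1 - x) p'.

    Since p_n is an eigenvector of the Jacobi operator for theta_n,
      D p_n = (P1(theta_n) / 2) p_n + P2(theta_n) Delta p_n.
    The expression of Delta p_n in the Jacobi basis may involve all p_i, i <= n,
    but with eps_n = (n + a) / (n + a + b) the combination
    Delta p_n + eps_n Delta p_(n-1) involves only p_n and p_(n-1)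
    (lemma [Delta_jacobi_pair]).  The number beta_n is chosen so that this
    combination is the one that occurs in D q_n: the basis r_j makes
    P2(theta_n) = gamma_(n+1) (lemma [gamma_seqE]), hence
    beta_n P2(theta_(n-1)) = beta_n gamma_n = eps_n P2(theta_n).  Thus D q_n is
    a combination of p_n and p_(n-1), whose p_(n-1) coefficient is
    beta_n lambda_n at once.  That the p_n coefficient is lambda_n means
      P1(theta_n) - P1(theta_(n-1))
        = sigma_(n+1) gamma_(n+1) + sigma_n gamma_n,
    so P1 is a discrete primitive, and its definition gives one term by
    term in j (lemmas [upoch_diff] and [P1_diff]).

    The facts on Jacobi polynomials come from the generating function
    (1 + t x)^N (1 + t y)^M, whose coefficient of t^m is [binom_conv] below:
    with x = (X + 1) / 2, y = (X - 1) / 2, N = n + a, M = n + b and m = n it is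
    p_n.  Pascal's rule and the absorption rule of binomial coefficients give
    its contiguity relations; the Jacobi operator is the composition of a
    lowering operator, the derivative, and a raising operator, which yields
    the eigenvalue, and the same relations yield [jacobi_struct].

    The order of D is read off leading coefficients: that of P(D_(a,b)) is
    lc(P) (1 - x^2)^(deg P), so P1, of degree k + 1, provides the
    highest order term. *)

Set Implicit Arguments.
Unset Strict Implicit.
Unset Printing Implicit Defensive.

Import Order.TTheory GRing.Theory Num.Theory.
Local Open Scope ring_scope.

(** * Convolutions of generalized binomial coefficients *)

Section BinomialConvolution.

Variable R : realFieldType.
Implicit Types (N M : R) (x y : {poly R}).

Lemma gbinom0 N : gbinom N 0 = 1.
Proof. by rewrite /gbinom big_ord0 fact0 divr1. Qed.

Lemma gbinom_absorb N j : j.+1%:R * gbinom N j.+1 = N * gbinom (N - 1) j.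
Proof.
rewrite /gbinom big_ord_recl subr0 factS natrM.
rewrite (eq_bigr (fun i : 'I_j => N - 1 - i%:R)) => [|i _]; last first.
  by rewrite lift0 -natr1; ring.
have j1 : j.+1%:R != 0 :> R by rewrite pnatr_eq0.
have jf : (j`!)%:R != 0 :> R by rewrite pnatr_eq0 -lt0n fact_gt0.
by field; rewrite jf nat1r j1.
Qed.

Lemma gbinom_pascal N j :
  gbinom N j.+1 = gbinom (N - 1) j.+1 + gbinom (N - 1) j.
Proof.
have j1 : j.+1%:R != 0 :> R by rewrite pnatr_eq0.
apply: (mulfI j1); rewrite gbinom_absorb mulrDr.
have -> : j.+1%:R * gbinom (N - 1) j.+1 = (N - 1 - j%:R) * gbinom (N - 1) j.
  rewrite /gbinom big_ord_recr /= factS natrM.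
  have jf : (j`!)%:R != 0 :> R by rewrite pnatr_eq0 -lt0n fact_gt0.
  by field; rewrite jf nat1r j1.
by rewrite -natr1; ring.
Qed.

(** The coefficient of t^m in (1 + t x)^N (1 + t y)^M. *)
Definition binom_conv x N y M (m : nat) : {poly R} :=
  \sum_(j < m.+1) (gbinom N j * gbinom M (m - j)) *: (x ^+ j * y ^+ (m - j)).

Lemma binom_conv0 x N y M : binom_conv x N y M 0 = 1.
Proof. by rewrite /binom_conv big_ord1 subnn !gbinom0 mulr1 scale1r mulr1. Qed.

Lemma binom_convC x N y M m : binom_conv x N y M m = binom_conv y M x N m.
Proof.
rewrite /binom_conv (reindex_inj rev_ord_inj) /=; apply: eq_bigr => i _.
by rewrite subSS (subKn (ltnSE (ltn_ord i))) mulrC [y ^+ _ * _]mulrC.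
Qed.

(** Coefficient form of (1 + t x)^N = (1 + t x)^(N - 1) (1 + t x), written so as to
    eliminate the exponent N - 1; [binom_conv_pascalr] is its mirror image in y. *)
Lemma binom_conv_pascall x N y M m :
  binom_conv x (N - 1) y M m.+1
  = binom_conv x N y M m.+1 - x * binom_conv x (N - 1) y M m.
Proof.
apply/esym/eqP; rewrite subr_eq; apply/eqP.
rewrite /binom_conv 2!(big_ord_recl m.+1) /= !gbinom0 -addrA; congr (_ + _).
rewrite mulr_sumr -big_split /=; apply: eq_bigr => i _.
rewrite /bump /= add1n subSS exprS (gbinom_pascal N) mulrDl scalerDl.
by rewrite -scalerAr !mulrA.
Qed.

Lemma binom_conv_pascalr x N y M m :
  binom_conv x N y (M - 1) m.+1
  = binom_conv x N y M m.+1 - y * binom_conv x N y (M - 1) m.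
Proof. by rewrite !(binom_convC x N) binom_conv_pascall. Qed.

Lemma binom_conv_absorbl x N y M m X :
  \sum_(j < m.+2) (gbinom N j * gbinom M (m.+1 - j)) *:
     (X * x ^+ j.-1 *+ j * y ^+ (m.+1 - j))
  = N%:P * X * binom_conv x (N - 1) y M m.
Proof.
rewrite big_ord_recl /= mulr0n mul0r scaler0 add0r /binom_conv mulr_sumr.
apply: eq_bigr => i _; rewrite /bump /= add1n subSS -!mul_polyC.
have E : i.+1%:R * (gbinom N i.+1)%:P = N%:P * (gbinom (N - 1) i)%:P.
  by rewrite -polyC_natr -!polyCM gbinom_absorb.
rewrite (polyCM (gbinom N _)) (polyCM (gbinom (N - 1) _)) -mulr_natl.
transitivity ((i.+1%:R * (gbinom N i.+1)%:P) * (gbinom M (m - i))%:P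
              * X * x ^+ i * y ^+ (m - i)); first by ring.
by rewrite E; ring.
Qed.

(** The action of a derivation with x |-> X and y |-> Y: the instance (X, Y) = (x, y)
    is the homogeneous Euler identity, and (X, Y) = (x', y') is the derivative. *)
Lemma binom_conv_absorb x N y M m X Y :
  \sum_(j < m.+2) (gbinom N j * gbinom M (m.+1 - j)) *:
     (X * x ^+ j.-1 *+ j * y ^+ (m.+1 - j)
      + x ^+ j * (Y * y ^+ (m.+1 - j).-1 *+ (m.+1 - j)))
  = N%:P * X * binom_conv x (N - 1) y M m + M%:P * Y * binom_conv x N y (M - 1) m.
Proof.
under eq_bigr do rewrite scalerDr.
rewrite big_split /= binom_conv_absorbl; congr (_ + _).
rewrite binom_convC -(binom_conv_absorbl y M x N m Y) (reindex_inj rev_ord_inj) /=.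
apply: eq_bigr => i _; rewrite subSS (subKn (ltnSE (ltn_ord i))).
by rewrite mulrC [x ^+ _ * _]mulrC [gbinom _ _ * _]mulrC.
Qed.

Lemma binom_conv_euler x N y M m :
  m.+1%:R * binom_conv x N y M m.+1
  = N%:P * x * binom_conv x (N - 1) y M m + M%:P * y * binom_conv x N y (M - 1) m.
Proof.
rewrite -binom_conv_absorb /binom_conv mulr_sumr; apply: eq_bigr => j _.
have pow (z : {poly R}) i : z * z ^+ i.-1 *+ i = i%:R * z ^+ i.
  by case: i => [|i]; rewrite ?mulr0n ?mul0r // -exprS -mulr_natl.
have E : m.+1%:R = j%:R + (m.+1 - j)%:R :> {poly R}.
  by rewrite -natrD subnKC // (ltnSE (ltn_ord j)).
by rewrite -scalerAr !pow E; congr (_ *: _); ring.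
Qed.

Lemma deriv_binom_conv x N y M m :
  (binom_conv x N y M m.+1)^`()
  = N%:P * x^`() * binom_conv x (N - 1) y M m + M%:P * y^`() * binom_conv x N y (M - 1) m.
Proof.
rewrite -binom_conv_absorb /binom_conv raddf_sum /=; apply: eq_bigr => j _.
by rewrite derivZ derivM !deriv_exp.
Qed.

(** The partial derivatives in x and y have a sum that is again a convolution with
    the exponents N and M: by Pascal's rule it is (N + M) times the convolution,
    less the Euler sum of total degree m. *)
Lemma binom_conv_lower x N y M m :
  N%:P * binom_conv x (N - 1) y M m + M%:P * binom_conv x N y (M - 1) m
  = (N + M - m%:R)%:P * binom_conv x N y M m.
Proof.
case: m => [|m]; first by rewrite !binom_conv0 subr0; ring.
have := binom_conv_euler x N y M m.
rewrite binom_conv_pascall binom_conv_pascalr polyCB polyCD polyC_natr mulrBl => ->.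
by ring.
Qed.

End BinomialConvolution.

(** * Jacobi polynomials *)

Section Jacobi.

Variable R : realFieldType.
Implicit Types (N M a b : R).

Definition halfXm : {poly R} := 2%:R^-1 *: ('X - 1).

Definition halfXp : {poly R} := 2%:R^-1 *: ('X + 1).

Lemma two_neq0 : 2%:R != 0 :> R. Proof. by rewrite pnatr_eq0. Qed.

Lemma halfXpE : halfXp = halfXm + 1.
Proof.
rewrite /halfXp /halfXm.
have -> : 'X + 1 = ('X - 1) + 2%:R%:P :> {poly R} by rewrite polyC_natr; ring.
rewrite scalerDr -mul_polyC; congr (_ + _).
by rewrite -mul_polyC -polyCM mulVf ?two_neq0.
Qed.

Lemma polyXE : 'X = 2%:R * halfXm + 1 :> {poly R}.
Proof.
rewrite -[2%:R]polyC_natr mul_polyC scalerA divff ?two_neq0 // scale1r; ring.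
Qed.

Lemma deriv_halfXm : halfXm^`() = 2%:R^-1%:P.
Proof. by rewrite derivZ derivB derivX derivC subr0 alg_polyC. Qed.

Lemma deriv_halfXp : halfXp^`() = 2%:R^-1%:P.
Proof. by rewrite derivZ derivD derivX derivC addr0 alg_polyC. Qed.

Lemma jacobiE a b n : jacobi a b n = binom_conv halfXp (n%:R + a) halfXm (n%:R + b) n.
Proof.
rewrite /jacobi /binom_conv scaler_sumr; apply: eq_bigr => j _.
rewrite !exprZn -scalerAl -scalerAr !scalerA -[in RHS]mulrA -exprD.
rewrite subnKC ?(ltnSE (ltn_ord j)) // exprVn mulrC [_ ^+ j * _]mulrC.
by [].
Qed.

Lemma jacobi0 a b : jacobi a b 0 = 1.
Proof. by rewrite jacobiE binom_conv0. Qed.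

Local Notation jform N M m := (binom_conv halfXp N halfXm M m).

Lemma deriv_jform_split N M m :
  2%:R * (jform N M m.+1)^`() = N%:P * jform (N - 1) M m + M%:P * jform N (M - 1) m.
Proof.
rewrite deriv_binom_conv deriv_halfXm deriv_halfXp.
have E : 2%:R * 2%:R^-1%:P = 1 :> {poly R}.
  by rewrite -[2%:R]polyC_natr -polyCM divff ?two_neq0.
transitivity ((2%:R * 2%:R^-1%:P)
              * (N%:P * jform (N - 1) M m + M%:P * jform N (M - 1) m)).
  by ring.
by rewrite E mul1r.
Qed.

Lemma deriv_jform N M m : 2%:R * (jform N M m.+1)^`() = (N + M - m%:R)%:P * jform N M m.
Proof. by rewrite deriv_jform_split binom_conv_lower. Qed.

(** A first order operator that raises m.  With x = (X + 1) / 2 and y = (X - 1) / 2,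
    1 - X^2 = - 4 x y and the coefficient of the term of order 0 is
    - 2 ((N - m) x + (M - m) y).  Through the Euler identity and Pascal's rule both
    sides then reduce to convolutions with one exponent lowered. *)
Lemma raise_jform N M m :
  (1 - 'X ^+ 2) * (jform N M m)^`()
    + ((M - N)%:P - (N + M - 2%:R * m%:R) *: 'X) * jform N M m
  = - 2%:R * (m.+1%:R * jform N M m.+1).
Proof.
have linE (c d e : R) : (c - d)%:P - (d + c - 2%:R * e) *: 'X
    = - 2%:R * (d%:P * halfXp + c%:P * halfXm) + 2%:R * e%:P * (halfXp + halfXm).
  rewrite -mul_polyC polyXE halfXpE polyCB polyCB polyCD polyCM polyC_natr.
  by ring.
rewrite linE polyC_natr.
case: m => [|m].
  by rewrite binom_conv_euler !binom_conv0 derivC; ring.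
rewrite (binom_conv_euler _ N _ M m.+1) binom_conv_pascall binom_conv_pascalr.
have sqE : 1 - 'X ^+ 2 = - 2%:R * halfXp * halfXm * 2%:R :> {poly R}.
  by rewrite polyXE halfXpE; ring.
transitivity (- 2%:R * halfXp * halfXm * (2%:R * (jform N M m.+1)^`())
   - 2%:R * (N%:P * halfXp + M%:P * halfXm) * jform N M m.+1
   + 2%:R * (halfXp + halfXm) * (m.+1%:R * jform N M m.+1)).
  by rewrite sqE; ring.
by rewrite deriv_jform_split binom_conv_euler; ring.
Qed.

(** The Jacobi operator is [raise_jform] after the derivative, and the derivative of p_n
    is, by [deriv_jform], a multiple of the Jacobi polynomial of degree n - 1 with
    parameters a + 1 and b + 1. *)
Lemma jacobi_eigen a b n :
  jacobi_op a b (jacobi a b n) = theta_seq a b n *: jacobi a b n.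
Proof.
rewrite /jacobi_op /theta_seq derivSn derivn1 jacobiE.
case: n => [|n].
  by rewrite binom_conv0 derivC deriv0 !mulr0 addr0 mul0r oppr0 scale0r.
set N := n.+1%:R + a; set M := n.+1%:R + b.
have E2 := deriv_jform N M n.
have E3 : 2%:R * (jform N M n.+1)^`()^`() = (N + M - n%:R)%:P * (jform N M n)^`().
  have /(congr1 (@deriv R)) := E2.
  by rewrite -polyC_natr !mul_polyC !derivZ.
have := raise_jform N M n.
have two : 2%:R != 0 :> {poly R} by rewrite -polyC_natr polyC_eq0 two_neq0.
move=> E; apply: (mulfI two).
set c1 := (b - a)%:P - _ *: _; set th := - (n.+1%:R * _).
have c1E : c1 = (M - N)%:P - (N + M - 2%:R * n%:R) *: 'X.
  rewrite /c1 /M /N; congr (_%:P - _ *: _); first by ring.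
  by rewrite -natr1; ring.
transitivity ((1 - 'X ^+ 2) * (2%:R * (jform N M n.+1)^`()^`())
              + c1 * (2%:R * (jform N M n.+1)^`())).
  by ring.
rewrite E3 E2 c1E.
transitivity ((N + M - n%:R)%:P * ((1 - 'X^2) * (jform N M n)^`() +
   ((M - N)%:P - (N + M - 2%:R * n%:R) *: 'X) * jform N M n)); first by ring.
rewrite E -mul_polyC.
have -> : th = - ((N + M - n%:R) * n.+1%:R).
  by rewrite /th /N /M -natr1; ring.
by rewrite polyCN polyCM polyC_natr; ring.
Qed.

(** Two contiguity relations carry this: n p_n + (1 - x) p_n' and
    (n + a + b) p_(n-1) - (1 - x) p_(n-1)' are both multiples of the Jacobi polynomial of
    degree n - 1 with parameters a and b + 1, with factors n + a and n + a + b. *)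
Lemma jacobi_struct a b n :
  (1 - 'X) * ((n.+1%:R + a + b)%:P * (jacobi a b n.+1)^`()
              + (n.+1%:R + a)%:P * (jacobi a b n)^`())
  = (n.+1%:R + a + b)%:P
    * ((n.+1%:R + a)%:P * jacobi a b n - n.+1%:R%:P * jacobi a b n.+1).
Proof.
have H1 : n.+1%:R * jacobi a b n.+1 + (1 - 'X) * (jacobi a b n.+1)^`()
   = (n.+1%:R + a)%:P * jform (n%:R + a) (n%:R + b + 1) n.
  rewrite jacobiE.
  set N := n.+1%:R + a; set M := n.+1%:R + b.
  have -> : n%:R + a = N - 1 by rewrite /N -natr1; ring.
  have -> : n%:R + b + 1 = M by rewrite /M -natr1; ring.
  transitivity (n.+1%:R * jform N M n.+1 - halfXm * (2%:R * (jform N M n.+1)^`())).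
    by rewrite polyXE; ring.
  by rewrite deriv_jform_split binom_conv_euler halfXpE; ring.
have H2 : (n.+1%:R + a + b)%:P * jacobi a b n - (1 - 'X) * (jacobi a b n)^`()
   = (n.+1%:R + a + b)%:P * jform (n%:R + a) (n%:R + b + 1) n.
  rewrite jacobiE; case: n {H1} => [|n]; first by rewrite !binom_conv0 derivC; ring.
  set N := n.+1%:R + a; set M := n.+1%:R + b.
  transitivity ((n.+2%:R + a + b)%:P * jform N M n.+1
                + halfXm * (2%:R * (jform N M n.+1)^`())).
    by rewrite polyXE; ring.
  have -> : jform N (M + 1) n.+1 = jform N M n.+1 + halfXm * jform N M n.
    have := binom_conv_pascalr halfXp N halfXm (M + 1) n.
    by rewrite addrK => ->; rewrite subrK.
  rewrite deriv_jform.
  have -> : N + M - n%:R = n.+2%:R + a + b.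
    by rewrite /N /M -!natr1; ring.
  by ring.
transitivity ((n.+1%:R + a + b)%:P *
   (n.+1%:R * jacobi a b n.+1 + (1 - 'X) * (jacobi a b n.+1)^`())
   - (n.+1%:R + a)%:P
     * ((n.+1%:R + a + b)%:P * jacobi a b n - (1 - 'X) * (jacobi a b n)^`())
   + (n.+1%:R + a + b)%:P
     * ((n.+1%:R + a)%:P * jacobi a b n - n.+1%:R%:P * jacobi a b n.+1)).
  by rewrite polyC_natr; ring.
by rewrite H1 H2; ring.
Qed.

(** In D, the first order factor to the left of P2(D_(a,b)). *)
Definition Delta a b (p : {poly R}) : {poly R} :=
  - ((a + b + 1) / 2%:R) *: p + (1 - 'X) * p^`().

(** This is [jacobi_struct] divided by n + 1 + a + b: the derivatives occur only in
    the combination that it rewrites as Jacobi polynomials. *)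
Lemma Delta_jacobi_pair a b n (eps := (n.+1%:R + a) / (n.+1%:R + a + b)) :
  n.+1%:R + a + b != 0 ->
  Delta a b (jacobi a b n.+1) + eps *: Delta a b (jacobi a b n)
  = - (sigma_seq a b n.+2 / 2%:R) *: jacobi a b n.+1
    + (eps * (sigma_seq a b n.+1 / 2%:R)) *: jacobi a b n.
Proof.
move=> e_neq0; have S := jacobi_struct a b n.
have epsE : (n.+1%:R + a + b) * eps = n.+1%:R + a by rewrite /eps mulrC divfK.
have -> : sigma_seq a b n.+2 / 2%:R = (a + b + 1) / 2%:R + n.+1%:R.
  by rewrite /sigma_seq -[n.+2%:R]natr1; field.
have -> : sigma_seq a b n.+1 / 2%:R = n.+1%:R + a + b - (a + b + 1) / 2%:R.
  by rewrite /sigma_seq; field.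
rewrite /Delta; move: epsE S e_neq0; move: eps ((a + b + 1) / 2%:R).
move: (jacobi a b n.+1) (jacobi a b n) => p p' eps c.
move: (n.+1%:R + a + b) => e; move: (n.+1%:R + a) (n.+1%:R) => f m.
move=> /(congr1 polyC); rewrite polyCM => epsE S e_neq0.
apply: (mulfI (x := e%:P)); first by rewrite polyC_eq0.
rewrite -!mul_polyC.
transitivity (- c%:P * (e%:P * p + (e%:P * eps%:P) * p')
  + (1 - 'X) * (e%:P * p^`() + (e%:P * eps%:P) * p'^`())); first by ring.
rewrite epsE S.
transitivity (- (c + m)%:P * (e%:P * p) + (e%:P * eps%:P) * (e - c)%:P * p').
  by rewrite epsE; ring.
by ring.
Qed.

End Jacobi.

(** * Values at the Jacobi eigenvalues *)

Section Values.

Variable R : realFieldType.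
Implicit Types (a b t : R).

(** With i-th factor -theta_n + (a + i + 1) (b - i) = (n + 1 + a + i) (n + b - i). *)
Lemma rpoly_theta a b j n :
  (rpoly a b j).[theta_seq a b n] = upoch a b j n.+1.
Proof.
rewrite /rpoly /upoch /poch horner_prod /theta_seq.
rewrite [X in _ = _ * X](reindex_inj rev_ord_inj) /= -big_split /=.
apply: eq_bigr => i _.
rewrite !hornerE natrB // -!natr1.
by ring.
Qed.

Lemma gamma_seqE a b k (w : nat -> R) n :
  (\sum_(j < k.+1) w j *: rpoly a b j).[theta_seq a b n] = gamma_seq a b k w n.+1.
Proof.
rewrite horner_sum; apply: eq_bigr => j _.
by rewrite hornerZ rpoly_theta.
Qed.

Lemma poch_recr t j : poch t j.+1 = poch t j * (t + j%:R).
Proof. by rewrite /poch big_ord_recr. Qed.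

Lemma poch_recl t j : poch t j.+1 = t * poch (t + 1) j.
Proof.
rewrite /poch big_ord_recl addr0; congr (_ * _).
by apply: eq_bigr => i _; rewrite lift0 -natr1; ring.
Qed.

(** With A = n + 1 + a, B = n + 1 + b and j >= 1, all terms share the factor
    (A + 1)_(j - 1) (B - j + 1)_(j - 1), and the identity reduces to one between
    polynomials in A, B and j. *)
Lemma upoch_diff a b j n :
  2%:R / j.+1%:R * (upoch a b j.+1 n.+2 - upoch a b j.+1 n.+1)
    + (a - b + 2%:R * j%:R + 1) * (upoch a b j n.+2 - upoch a b j n.+1)
  = sigma_seq a b n.+2 * upoch a b j n.+2 + sigma_seq a b n.+1 * upoch a b j n.+1.
Proof.
rewrite /upoch /sigma_seq.
have j1 : j.+1%:R != 0 :> R by rewrite pnatr_eq0.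
set A := n.+1%:R + a; set B := n.+1%:R + b.
have -> : n.+2%:R + a = A + 1 by rewrite /A -natr1; ring.
have -> : n.+2%:R + b = B + 1 by rewrite /B -[n.+2%:R]natr1; ring.
have -> : 2 * n.+2%:R + a + b - 1 = A + B + 1.
  by rewrite /A /B -[n.+2%:R]natr1; ring.
have -> : 2 * n.+1%:R + a + b - 1 = A + B - 1 by rewrite /A /B; ring.
have -> : a - b = A - B by rewrite /A /B; ring.
(* The common factor X * Y is meaningful for j >= 1 only. *)
case: j j1 => [|j] j1; first by rewrite !poch_recr /poch !big_ord0; field.
set X := poch (A + 1) j; set Y := poch (B - j%:R) j.
have XS : poch (A + 1) j.+1 = X * (A + 1 + j%:R) by rewrite poch_recr.
have XSS : poch (A + 1) j.+2 = X * (A + 1 + j%:R) * (A + 1 + j%:R + 1).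
  by rewrite poch_recr XS -natr1; ring.
have YS : poch (B - j%:R) j.+1 = Y * B by rewrite poch_recr subrK.
have shift (c : R) i : c - i.+1%:R + 1 = c - i%:R by rewrite -natr1; ring.
have YP : poch (B - j.+1%:R) j.+1 = (B - j.+1%:R) * Y by rewrite poch_recl shift.
have YPP : poch (B - j.+2%:R) j.+2 = (B - j.+2%:R) * (B - j.+1%:R) * Y.
  by rewrite poch_recl shift YP mulrA.
have YPS : poch (B - j.+1%:R) j.+2 = (B - j.+1%:R) * Y * B.
  by rewrite poch_recl shift YS mulrA.
have up i : B + 1 - i.+1%:R = B - i%:R by rewrite -natr1; ring.
rewrite !up !(poch_recl A) XS XSS YS YP YPP YPS.
rewrite -/X; field.
by rewrite -natrD.
Qed.

Lemma P1_diff a b k w n (P1 := P1_of a b k w) :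
  P1.[theta_seq a b n.+1] - P1.[theta_seq a b n]
  = sigma_seq a b n.+2 * gamma_seq a b k w n.+2
    + sigma_seq a b n.+1 * gamma_seq a b k w n.+1.
Proof.
rewrite /P1 /P1_of /gamma_seq !horner_sum -sumrB !mulr_sumr -big_split /=.
apply: eq_bigr => j _; rewrite !(hornerZ, hornerD) !rpoly_theta.
rewrite -[RHS]/(_ * (w j * _) + _ * (w j * _)) !(mulrCA _ (w j)) -mulrDr -upoch_diff.
by ring.
Qed.

End Values.

(** * Orders of differential operators *)

Section Order.

Variable R : realFieldType.
Implicit Types (a b : R) (p q P l : {poly R}) (T : {poly R} -> {poly R}).

(** The coefficient l of the m-th derivative may vanish, so that operators of lower order
    can be added; it is tracked because its value decides the exact order in the end. *)
Definition diff_op_lead (m : nat) (l : {poly R}) T :=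
  exists2 c : nat -> {poly R},
    c m = l & forall p, T p = \sum_(i < m.+1) c i * p^`(i).

Lemma diff_op_lead_id : diff_op_lead 0 1 id.
Proof. by exists (fun=> 1) => // p; rewrite big_ord1 mul1r. Qed.

Lemma diff_op_lead_widen m l T : diff_op_lead m l T -> diff_op_lead m.+1 0 T.
Proof.
case=> c _ cT; exists (fun i => if i == m.+1 then 0 else c i) => [|p].
  by rewrite eqxx.
rewrite big_ord_recr /= eqxx mul0r addr0 cT; apply: eq_bigr => i _.
by rewrite ltn_eqF.
Qed.

Lemma diff_op_lead_add m l1 l2 T1 T2 : diff_op_lead m l1 T1 -> diff_op_lead m l2 T2 ->
  diff_op_lead m (l1 + l2) (fun p => T1 p + T2 p).
Proof.
case=> c1 <- E1 [c2 <- E2]; exists (fun i => c1 i + c2 i) => // p.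
rewrite E1 E2 -big_split; apply: eq_bigr => i _; exact: (esym (mulrDl _ _ _)).
Qed.

Lemma diff_op_lead_mul m l T q : diff_op_lead m l T ->
  diff_op_lead m (q * l) (fun p => q * T p).
Proof.
case=> c <- E; exists (fun i => q * c i) => // p.
by rewrite E mulr_sumr; apply: eq_bigr => i _; rewrite mulrA.
Qed.

Lemma diff_op_lead_deriv m l T : diff_op_lead m l T ->
  diff_op_lead m.+1 l (fun p => (T p)^`()).
Proof.
case=> c <- E.
(* Leibniz rule: c i * p^`(i) contributes c i at i.+1 and (c i)^`() at i. *)
exists (fun i => (if i is j.+1 then c j else 0) + (if i == m.+1 then 0 else (c i)^`())).
  by rewrite eqxx addr0.
move=> p; rewrite E raddf_sum /=.
under [RHS]eq_bigr => i _ do rewrite mulrDl.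
rewrite big_split /= [X in _ = X + _]big_ord_recl mul0r add0r.
rewrite [X in _ = _ + X]big_ord_recr /= eqxx mul0r addr0 -big_split.
apply: eq_bigr => i _.
by rewrite derivM ltn_eqF // -derivnS; exact: addrC.
Qed.

Lemma diff_op_lead_eq m l l' T T' : l = l' -> T =1 T' ->
  diff_op_lead m l T -> diff_op_lead m l' T'.
Proof. by move=> <- ET [c cm E]; exists c => // p; rewrite -ET. Qed.

Lemma diff_op_lead_jacobi a b m l T : diff_op_lead m l T ->
  diff_op_lead m.+2 ((1 - 'X ^+ 2) * l) (fun p => jacobi_op a b (T p)).
Proof.
move=> hT; have hT' := diff_op_lead_deriv hT.
have h2 := diff_op_lead_mul (1 - 'X ^+ 2) (diff_op_lead_deriv hT').
have h1 := diff_op_lead_mul ((b - a)%:P - (a + b + 2%:R) *: 'X) (diff_op_lead_widen hT').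
by apply: diff_op_lead_eq (diff_op_lead_add h2 h1) => [|p //]; rewrite mulr0 addr0.
Qed.

Lemma diff_op_lead_poly_op a b P n : size P = n.+1 ->
  diff_op_lead n.*2 (lead_coef P *: (1 - 'X ^+ 2) ^+ n) (poly_op P (jacobi_op a b)).
Proof.
move=> sP; rewrite lead_coefE sP /=.
have it j : diff_op_lead j.*2 ((1 - 'X ^+ 2) ^+ j) (iter j (jacobi_op a b)).
  elim: j => [|j IH]; first exact: diff_op_lead_id.
  by rewrite exprS; apply: diff_op_lead_jacobi.
rewrite /poly_op sP; elim: n {sP} => [|n IH].
  apply: diff_op_lead_eq (diff_op_lead_mul (P`_0)%:P (it 0)) => [|p].
    by rewrite mul_polyC.
  by rewrite big_ord1 mul_polyC.
rewrite -[X in diff_op_lead _ X]add0r.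
apply: (@diff_op_lead_eq _ (0 + (P`_n.+1)%:P * (1 - 'X ^+ 2) ^+ n.+1) _
  (fun p => \sum_(j < n.+1) P`_j *: iter j (jacobi_op a b) p
          + (P`_n.+1)%:P * iter n.+1 (jacobi_op a b) p)) => [|p|].
- by rewrite mul_polyC.
- by rewrite [RHS]big_ord_recr mul_polyC.
apply: diff_op_lead_add; first by do 2! apply: diff_op_lead_widen; exact: IH.
exact: diff_op_lead_mul.
Qed.

Lemma size_rpoly a b j : size (rpoly a b j) = j.+1.
Proof.
rewrite /rpoly; elim: j => [|j IH]; first by rewrite big_ord0 size_poly1.
have s2 (c : R) : size (- 'X + c%:P) = 2%N.
  by rewrite -size_polyN opprD opprK -polyCN size_XaddC.
rewrite big_ord_recr size_mul ?IH /= ?s2 ?addn2 //; last by rewrite -size_poly_eq0 s2.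
by rewrite -size_poly_eq0 IH.
Qed.

Lemma size_sum_leq k n (F : 'I_k -> {poly R}) :
  (forall i, size (F i) <= n)%N -> (size (\sum_i F i)%R <= n)%N.
Proof.
move=> Fn; apply: (big_ind (fun p : {poly R} => size p <= n)%N) => // [|p q sp sq].
  by rewrite size_poly0.
by apply: leq_trans (size_polyD _ _) _; rewrite geq_max sp.
Qed.

Lemma size_rsum a b (w : nat -> R) n : (size (\sum_(j < n) w j *: rpoly a b j)%R <= n)%N.
Proof.
apply: size_sum_leq => i.
by apply: leq_trans (size_scale_leq _ _) _; rewrite size_rpoly.
Qed.

(** The degree of P2 being k forces w k != 0, and r_(k+1) occurs only in the last term. *)
Lemma size_P1 a b k (w : nat -> R) : size (\sum_(j < k.+1) w j *: rpoly a b j) = k.+1 ->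
  size (P1_of a b k w) = k.+2.
Proof.
move=> sP.
have wk : w k != 0.
  apply/eqP => wk; move: sP; rewrite big_ord_recr /= wk scale0r addr0 => sP.
  by have := size_rsum a b w k; rewrite sP ltnn.
have szk : size (w k *: ((2%:R / k.+1%:R) *: rpoly a b k.+1)) = k.+2.
  rewrite scalerA size_scale ?size_rpoly //.
  by rewrite mulf_neq0 // mulf_neq0 ?invr_eq0 ?pnatr_eq0.
rewrite /P1_of big_ord_recr /= scalerDr addrCA size_polyDl szk //.
rewrite ltnS; apply: leq_trans (size_polyD _ _) _; rewrite geq_max; apply/andP; split.
  apply: size_sum_leq => i.
  apply: leq_trans (size_scale_leq _ _) _; apply: leq_trans (size_polyD _ _) _.
  rewrite geq_max !(leq_trans (size_scale_leq _ _)) ?size_rpoly // ltnS.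
    exact: ltnW.
  exact: ltn_ord.
by rewrite scalerA (leq_trans (size_scale_leq _ _)) ?size_rpoly.
Qed.

(** Only the term P1(D_(a,b)) / 2 reaches order 2 k + 2: the other one has order 2 k + 1. *)
Lemma D_op_order a b P1 P2 k : size P1 = k.+2 -> size P2 = k.+1 ->
  diff_op_of_order (2 * k + 2)%N (D_op a b P1 P2).
Proof.
move=> s1 s2.
have h1 := diff_op_lead_mul (2%:R^-1)%:P (diff_op_lead_poly_op a b s1).
have h2 := diff_op_lead_poly_op a b s2.
have h3 := diff_op_lead_mul (1 - 'X) (diff_op_lead_deriv h2).
have h4 := diff_op_lead_mul (- ((a + b + 1) / 2%:R))%:P (diff_op_lead_widen h2).
have [c cE E] := diff_op_lead_add h1 (diff_op_lead_widen (diff_op_lead_add h4 h3)).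
rewrite addnC mul2n; exists c; split=> [|p]; last first.
  by rewrite -E /D_op -!mul_polyC.
rewrite cE addr0 mul_polyC !scaler_eq0 invr_eq0 pnatr_eq0 /=.
rewrite lead_coef_eq0 -size_poly_eq0 s1 /=.
rewrite expf_neq0 //; apply/eqP => /(congr1 (horner^~ 0)).
by rewrite !hornerE expr0n subr0 => /eqP; rewrite oner_eq0.
Qed.

End Order.

(** * Action of D on Jacobi polynomials *)

Section Action.

Variable R : realFieldType.
Implicit Types (a b t c : R) (p q P : {poly R}).

Lemma jacobi_opZ a b c p : jacobi_op a b (c *: p) = c *: jacobi_op a b p.
Proof. by rewrite /jacobi_op derivnZ derivZ -!scalerAr scalerDr. Qed.

Lemma jacobi_opD a b p q : jacobi_op a b (p + q) = jacobi_op a b p + jacobi_op a b q.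
Proof. by rewrite /jacobi_op derivnD derivD; ring. Qed.

Lemma poly_opD P a b p q : poly_op P (jacobi_op a b) (p + q) =
  poly_op P (jacobi_op a b) p + poly_op P (jacobi_op a b) q.
Proof.
have itD j : iter j (jacobi_op a b) (p + q)
           = iter j (jacobi_op a b) p + iter j (jacobi_op a b) q.
  by elim: j => //= j ->; exact: jacobi_opD.
by rewrite -big_split; apply: eq_bigr => j _; rewrite itD scalerDr.
Qed.

Lemma poly_op_eigen P a b t p c : jacobi_op a b p = t *: p ->
  poly_op P (jacobi_op a b) (c *: p) = (c * P.[t]) *: p.
Proof.
move=> E.
have it j : iter j (jacobi_op a b) (c *: p) = (c * t ^+ j) *: p.
  elim: j => [|j IH]; first by rewrite expr0 mulr1.
  by rewrite iterS IH jacobi_opZ E scalerA exprSr mulrA.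
rewrite horner_coef mulr_sumr scaler_suml; apply: eq_bigr => j _.
by rewrite it scalerA mulrCA.
Qed.

Lemma D_op_eigen a b P1 P2 t p c : jacobi_op a b p = t *: p ->
  D_op a b P1 P2 (c *: p) = c *: ((P1.[t] / 2%:R) *: p + P2.[t] *: Delta a b p).
Proof.
move=> E; rewrite /D_op /Delta !(poly_op_eigen _ _ E).
rewrite -!mul_polyC derivM derivC mul0r add0r.
by ring.
Qed.

Lemma D_op_add a b P1 P2 p q :
  D_op a b P1 P2 (p + q) = D_op a b P1 P2 p + D_op a b P1 P2 q.
Proof. by rewrite /D_op !poly_opD derivD !scalerDr mulrDr; ring. Qed.

End Action.

(** * The eigenvalue equation *)

Theorem theorem8p8 (R : realFieldType) (a b : R) (k : nat) (w : nat -> R)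
    (P2 : {poly R})
    (hab : forall m : nat, a + b <> - m.+1%:R)
    (hk : (1 <= k)%N)
    (hdeg : size P2 = k.+1)
    (hP2 : P2 = \sum_(j < k.+1) w j *: rpoly a b j)
    (hgamma : forall n : nat, gamma_seq a b k w n <> 0) :
  let P1 := P1_of a b k w in
  let D := D_op a b P1 P2 in
  [/\ size P1 = k.+2,
      diff_op_of_order (2 * k + 2)%N D
    & forall n : nat,
        D (q_seq a b k w n) = lambda_seq a b k w P2 n *: q_seq a b k w n].
Proof.
move=> P1 D.
have sP1 : size P1 = k.+2 by apply: size_P1; rewrite -hP2.
split=> //; first exact: D_op_order.
case=> [|n].
  have E : jacobi_op a b 1 = 0 *: 1.
    by have := jacobi_eigen a b 0; rewrite jacobi0 /theta_seq mul0r oppr0.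
  have := D_op_eigen P1 P2 1 E; rewrite !scale1r -/D => ->.
  rewrite /Delta derivC mulr0 addr0 /= scalerA -scalerDl; congr (_ *: _).
  by rewrite /P1; field.
have P2E m : P2.[theta_seq a b m] = gamma_seq a b k w m.+1.
  by rewrite hP2 gamma_seqE.
have e_neq0 : n.+1%:R + a + b != 0.
  by apply/eqP => h; apply: (hab n); rewrite -[RHS]addr0 -h; ring.
have pair := Delta_jacobi_pair e_neq0.
set eps := _ / _ in pair.
rewrite /q_seq; set be := beta_seq _ _ _ _ _.
have beE : be * gamma_seq a b k w n.+1 = eps * gamma_seq a b k w n.+2.
  by rewrite /be /beta_seq -/eps -mulrA divfK //; apply/eqP; exact: hgamma.
rewrite /D D_op_add -{1}[jacobi a b n.+1]scale1r.
rewrite !(D_op_eigen _ _ _ (jacobi_eigen a b _)) !P2E scale1r.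
have /eqP := P1_diff a b k w n; rewrite subr_eq -/P1 => /eqP ->.
rewrite /lambda_seq -/P1; move: pair beE; clearbody be eps.
move: (Delta a b (jacobi a b n.+1)) (Delta a b (jacobi a b n)) => d d'.
move: (jacobi a b n.+1) (jacobi a b n) => p p'.
move: (gamma_seq a b k w n.+2) (gamma_seq a b k w n.+1) => g g'.
move: (sigma_seq a b n.+2) (sigma_seq a b n.+1) P1.[_] => s s' t.
move=> pair beE.
transitivity (((s * g + s' * g' + t) / 2%:R) *: p + g *: (d + eps *: d')
              + (be * (t / 2%:R)) *: p').
  by rewrite !scalerDr !scalerA beE [eps * g]mulrC; ring.
rewrite pair !scalerDr !scalerA.
have -> : (s' * g' + t) / 2%:R * be = be * g' * (s' / 2%:R) + be * (t / 2%:R).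
  by ring.
by rewrite beE -!mul_polyC; ring.
Qed.
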